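(* Let $k\ge3$ be an integer, let $0<\alpha<1/(10k)$, let $n$ be sufficiently large (in terms of $k$ and $\alpha$), and let $t=2\lceil\alpha n\rceil$. Let $S_1,\dots,S_t$ be pairwise disjoint $(k-1)$-subsets of an $n$-element vertex set. Let $G$ be a $k$-graph obtained from the complete $k$-graph on this vertex set by retaining, for each $j\in\{1,\dots,t\}$, exactly $1+\lceil\alpha n\rceil$ edges containing $S_j$ and deleting all other edges containing $S_j$ (edges containing no $S_j$ are all kept). Then: (1) under every ordering of $V(G)$ (i.e. every identification of $V(G)$ with $[n]$), for every $A\in\binom{[n]}{k-2}$ and every integer $r$ with $1\le r<\min\{\min A,(n-k+2)/2\}$, we have $c_r(A)\ge r+\alpha n$; (2) there is no ordering of $V(G)$ (identification of $V(G)$ with $[n]$) under which $d(S)\ge\min\{\min S,(n-k+2)/2\}+1$ holds for every $S\in\binom{V(G)}{k-1}$.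
   Context: A $k$-graph is a $k$-uniform hypergraph, and $[n]=\{1,\dots,n\}$. For a $k$-graph $G$ and $S\subseteq V(G)$, $d(S)=|\{e\in E(G): S\subseteq e\}|$. For $A\in\binom{V(G)}{k-2}$, $c_1(A)\le c_2(A)\le\cdots\le c_{|V(G)|-k+2}(A)$ denotes the non-decreasing arrangement of the multiset $\{d(A\cup\{x\}) : x\in V(G)\setminus A\}$. Once $V(G)$ is identified with $[n]$, $\min A$ and $\min S$ denote the smallest elements of $A$ and $S$. Since $k\ge 3$, no edge contains two distinct sets $S_i,S_j$, so the construction is well defined (the choice of retained edges being arbitrary). *)

(* Defs.v *)
From mathcomp Require Import all_boot all_order all_algebra.
From mathcomp Require Import reals.

Set Implicit Arguments.
Unset Strict Implicit.
Unset Printing Implicit Defensive.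

Import Order.TTheory GRing.Theory Num.Theory.

Section Hypergraphs.
Variable V : finType.
Implicit Types (G : {set {set V}}) (A S e : {set V}).

(* A k-graph on V is given by its edge set, a set of k-subsets of V. *)
Definition complete_kgraph (k : nat) : {set {set V}} := [set e : {set V} | #|e| == k].

Definition edges_containing G S : {set {set V}} := [set e in G | S \subset e].

Definition deg G S : nat := #|edges_containing G S|.

(* c_r(A) is indexed from r = 1; it is the junk value 0 when r > #|~: A|. *)
Definition codeg_seq G A : seq nat :=
  sort leq [seq deg G (x |: A) | x <- enum (~: A)].

Definition codeg G A (r : nat) : nat := nth 0 (codeg_seq G A) r.-1.

(* E j is the set of retained edges among those containing S j. *)
Definition retain_edges (k t : nat) (S : 'I_t -> {set V})
    (E : 'I_t -> {set {set V}}) : {set {set V}} :=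
  complete_kgraph k
    :\: \bigcup_(j < t) (edges_containing (complete_kgraph k) (S j) :\: E j).

(* An identification of V with [n] is a bijection f : V -> 'I_n, the vertex x
   being labelled (f x).+1.  All labels are at most n, so the unit n of the
   iterated minimum does not affect the value on nonempty sets. *)
Definition min_label (n : nat) (f : V -> 'I_n) A : nat :=
  \big[minn/n]_(x in A) (f x).+1.

End Hypergraphs.

(* Ceiling as a natural number; meant for 0 <= x only. *)
Definition ceiln (R : realType) (x : R) : nat := `|Num.ceil x|%N.

(* Main.v *)
(** Put [m = ceil (alpha n)].  A [(k-1)]-set [T] other than the [S j] lies in at
    most [k - 1] deleted edges: such an edge is [T :|: S j] for some [S j]
    meeting [T], and by disjointness [j] is determined by a point of [T].  So [T]
    has degree close to [n], while [S j] has degree exactly [m + 1].  A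
    [(k-2)]-set extends to at most one [S j], hence only [c_1(A)] can be as
    small as [m + 1], which gives (1).  For (2), the [2 m] disjoint sets [S j]
    have distinct minima, so some [min (S j)] is at least [2 m > m]. *)

Require Import Defs.
From mathcomp Require Import all_boot all_order all_algebra.
From mathcomp Require Import reals.
From mathcomp Require Import zify lra.

Set Implicit Arguments.
Unset Strict Implicit.
Unset Printing Implicit Defensive.

Import Order.TTheory GRing.Theory Num.Theory.
Local Open Scope ring_scope.

(** If the sorted entry at index [i] were below [b], so would be the [i.+1] first sorted entries,
    exceeding the count. *)
Lemma leq_nth_sort (s : seq nat) (i b : nat) :
  (i < size s)%N -> (count (fun x => x < b)%N s <= i)%N ->
  (b <= nth 0 (sort leq s) i)%N.
Proof.
move=> lt_i le_count; rewrite leqNgt; apply/negP => lt_b.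
have srt : sorted leq (sort leq s) by apply: sort_sorted; exact: leq_total.
have lt_i' : (i < size (sort leq s))%N by rewrite size_sort.
suff: (i < count (fun x => x < b)%N s)%N by rewrite ltnNge le_count.
rewrite -(permP (permEl (perm_sort leq s))) -[X in count _ X](cat_take_drop i.+1).
rewrite count_cat; apply: leq_trans (leq_addr _ _).
have sz : size (take i.+1 (sort leq s)) = i.+1 by rewrite size_takel.
suff: all (fun x => x < b)%N (take i.+1 (sort leq s)).
  by rewrite all_count sz => /eqP->.
apply/(all_nthP 0) => j; rewrite sz => lt_j; rewrite nth_take //.
apply: leq_ltn_trans lt_b; apply: (sorted_leq_nth leq_trans leqnn) => //.
by rewrite inE (leq_trans lt_j).
Qed.

Section MinLabel.
Variables (V : finType) (n : nat) (f : V -> 'I_n).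

Lemma leq_min_label (A : {set V}) (b : nat) :
  (b <= n)%N -> (forall x, x \in A -> (b <= (f x).+1)%N) ->
  (b <= min_label f A)%N.
Proof.
move=> le_bn le_bA; rewrite /min_label.
by elim/big_ind: _ => // x y le_bx le_by; rewrite leq_min le_bx.
Qed.

(** Pigeonhole: otherwise each [S j] has a point with [f x < t.-1] (labels are shifted by one), and
    by disjointness these points inject ['I_t] into ['I_t.-1]. *)
Lemma disjoint_family_min_label (t : nat) (S : 'I_t -> {set V}) :
  injective f -> (0 < t)%N -> (t <= n)%N ->
  (forall i j, i != j -> [disjoint S i & S j]) ->
  exists j, (t <= min_label f (S j))%N.
Proof.
move=> inj_f t_gt0 le_tn disj; apply/existsP; apply: contraT => /existsPn small.
have low j : {x | x \in S j & (f x < t.-1)%N}.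
  apply: sig2W; apply/exists_inP; apply: contraT => /exists_inPn high.
  have /negP[] := small j; apply: leq_min_label => // x xS.
  by have := high x xS; lia.
pose h j := Ordinal (s2valP' (low j)).
have inj_h : injective h.
  move=> i j /(congr1 val)/= /ord_inj/inj_f eq_ij.
  apply/eqP; apply: contraT => /disj/disjointFr/(_ (s2valP (low i))).
  by rewrite eq_ij (s2valP (low j)).
by have := leq_card h inj_h; rewrite !card_ord; lia.
Qed.

End MinLabel.

Section Degrees.
Variables (V : finType) (k t : nat).
Variables (S : 'I_t -> {set V}) (E : 'I_t -> {set {set V}}).
Hypothesis k_ge3 : (3 <= k)%N.
Hypothesis card_S : forall j, #|S j| = (k - 1)%N.
Hypothesis disj_S : forall i j, i != j -> [disjoint S i & S j].
Hypothesis sub_E :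
  forall j, E j \subset edges_containing (complete_kgraph V k) (S j).

Local Notation G := (retain_edges k S E).

Lemma common_point_eq i j x : x \in S i -> x \in S j -> i = j.
Proof.
move=> xi xj; apply/eqP; apply: contraT => /disj_S/disjointFr/(_ xi).
by rewrite xj.
Qed.

(** An edge of [E j] could only be lost on account of another [S i], but then its [k] points would
    include the [2 * (k - 1) > k] points of [S i :|: S j]. *)
Lemma edges_containing_retained j : edges_containing G (S j) = E j.
Proof.
apply/setP => e; rewrite !inE; apply/idP/idP.
  case/andP => /andP[ndel card_e] Se; apply: contraR ndel => nE.
  by apply/bigcupP; exists j; rewrite // !inE nE card_e.
move=> eE; have := subsetP (sub_E j) _ eE; rewrite !inE => /andP[card_e Se].
rewrite card_e Se !andbT; apply/bigcupP => -[i _]; rewrite !inE.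
case/andP => nE /andP[_ Sie].
have neq_ij : i != j by apply: contraNneq nE => ->.
have sub_e : S i :|: S j \subset e by rewrite subUset Sie.
have := subset_leq_card sub_e; rewrite cardsU (eqP card_e) !card_S.
by rewrite (disjoint_setI0 (disj_S neq_ij)) cards0; lia.
Qed.

Lemma deleted_edge_eq (T e : {set V}) j :
  #|T| = (k - 1)%N -> #|e| = k -> T != S j -> T \subset e -> S j \subset e ->
  e = T :|: S j.
Proof.
move=> card_T card_e neqT Te Se; apply/esym/eqP.
rewrite eqEcard subUset Te Se card_e leqNgt; apply/negP => lt_k.
have le_T : #|T :|: S j| = #|T|.
  apply/eqP; rewrite eqn_leq [X in _ && X]subset_leq_card ?subsetUl // andbT.
  by rewrite card_T; lia.
case/negP: neqT; rewrite eq_sym eqEcard card_T card_S leqnn andbT.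
have /eqP-> : T == T :|: S j by rewrite eqEcard subsetUl le_T leqnn.
exact: subsetUr.
Qed.

(** Among the [#|V| - (k - 1)] sets [y |: T], those deleted all lie in a family of at most
    [#|T| = k - 1] sets. *)
Lemma leq_deg_retained (T : {set V}) :
  #|T| = (k - 1)%N -> (forall j, T != S j) ->
  (#|V| <= deg G T + 2 * (k - 1))%N.
Proof.
move=> card_T neqT.
(* At most one [j] contributes to each union. A point [z] outside every [S j] yields [T] itself,
   which is harmless in an upper bound on [#|D|]. *)
pose D := [set T :|: \bigcup_(j | z \in S j) S j | z in T].
pose K := [set y |: T | y in ~: T].
have card_K : #|K| = #|~: T|.
  apply: card_in_imset => x y; rewrite !inE => xT yT /setP/(_ x).
  by rewrite !inE eqxx (negPf xT) !orbF => /esym/eqP.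
have sub_K : K \subset edges_containing G T :|: D.
  apply/subsetP => e /imsetP[y]; rewrite inE => yT def_e.
  have Te : T \subset e by rewrite def_e subsetUr.
  have card_e : #|e| = k by rewrite def_e cardsU1 yT card_T; lia.
  rewrite inE orbC -implyNb; apply/implyP => nD; rewrite !inE Te andbT card_e eqxx.
  rewrite andbT; apply: contra nD => /bigcupP[j _]; rewrite !inE => /and3P[_ _ Se].
  have eqe := deleted_edge_eq card_T card_e (neqT j) Te Se.
  (* The two sizes add up to [2 * (k - 1)], more than the [k] points of the union. *)
  have /set0Pn[z] : T :&: S j != set0.
    rewrite -cards_eq0; have := cardsUI T (S j).
    by rewrite -eqe card_e card_T card_S; lia.
  rewrite inE => /andP[zT zS]; apply/imsetP; exists z => //.
  rewrite eqe; congr (_ :|: _); rewrite (big_pred1 j) // => i /=.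
  by apply/idP/eqP => [zi|->//]; exact: common_point_eq zi zS.
have le_K := leq_trans (subset_leq_card sub_K) (leq_card_setU _ _).
have le_D : (#|D| <= #|T|)%N by exact: leq_imset_card.
rewrite card_T in le_D; rewrite -(cardsC T) card_T -card_K.
apply: leq_trans (leq_add (leqnn _) le_K) _.
by rewrite -/(deg G T); lia.
Qed.

Section ExtensionSequence.
Variable A : {set V}.
Hypothesis card_A : #|A| = (k - 2)%N.

Lemma size_extension_degs :
  size [seq deg G (x |: A) | x <- enum (~: A)] = (#|V| - (k - 2))%N.
Proof. by rewrite size_map -cardE -(cardsC A) card_A addKn. Qed.

Lemma card_extension x : x \notin A -> #|x |: A| = (k - 1)%N.
Proof. by move=> xA; rewrite cardsU1 xA card_A; lia. Qed.

(** Each extension of [A] is either some [S j], of degree [#|E j|], or of degree at least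
    [#|V| - 2 * (k - 1)]. *)
Lemma leq_codeg1 (b : nat) :
  (forall j, b <= #|E j|)%N -> (b + 2 * (k - 1) <= #|V|)%N ->
  (b <= codeg G A 1)%N.
Proof.
move=> le_bE le_bV; apply: leq_nth_sort; first by rewrite size_extension_degs; lia.
rewrite leqNgt -has_count; apply/hasPn => d /mapP[x].
rewrite mem_enum inE => xA -> /=; rewrite -leqNgt.
have card_T := card_extension xA.
case: (pickP (fun j => x |: A == S j)) => [j /eqP->|neqS].
  by rewrite /deg edges_containing_retained.
have neqT j : x |: A != S j by rewrite neqS.
by have := leq_deg_retained card_T neqT; lia.
Qed.

(** Only an extension equal to some [S j] can have lower degree. Two such extensions share the
    points of [A], which is nonempty as [k >= 3], so they coincide. *)
Lemma leq_codeg (r : nat) :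
  (1 < r)%N -> (r <= #|V| - (k - 2))%N ->
  (#|V| <= codeg G A r + 2 * (k - 1))%N.
Proof.
move=> r_gt1 le_r; rewrite addnC -leq_subLR.
apply: leq_nth_sort; first by rewrite size_extension_degs; lia.
(* At most one entry is small, and [r.-1 >= 1]. *)
apply: (@leq_trans 1%N); last by lia.
rewrite count_map -size_filter; set s := filter _ _.
have uniq_s : uniq s by rewrite filter_uniq ?enum_uniq.
have ext_s x : x \in s -> x \notin A /\ exists j, x |: A = S j.
  rewrite mem_filter mem_enum in_setC /= => /andP[lt_d xA]; split=> //.
  have card_T := card_extension xA.
  case: (pickP (fun j => x |: A == S j)) => [j /eqP eqS|neqS]; first by exists j.
  have neqT j : x |: A != S j by rewrite neqS.
  by rewrite ltnNge leq_subLR addnC leq_deg_retained in lt_d.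
have /card_gt0P[a aA] : (0 < #|A|)%N by rewrite card_A; lia.
case: s uniq_s ext_s => [|x [|y s]] //= /andP[xs _] ext_s.
have [xA [i eqi]] := ext_s x (mem_head _ _).
have [yA [j eqj]] : y \notin A /\ exists j, y |: A = S j.
  by apply: ext_s; rewrite !inE eqxx orbT.
have eq_ij : i = j by apply: (@common_point_eq _ _ a); rewrite -?eqi -?eqj inE aA orbT.
have : x \in y |: A by rewrite eqj -eq_ij -eqi setU11.
by rewrite !inE (negPf xA) orbF => /eqP eq_xy; rewrite eq_xy mem_head in xs.
Qed.

End ExtensionSequence.

End Degrees.

Lemma ceiln_itv (R : realType) (x : R) :
  0 <= x -> x <= (ceiln x)%:R < x + 1.
Proof.
move=> x_ge0; rewrite /ceiln natr_absz ger0_norm; last by rewrite ceil_ge0; lra.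
by have := ceil_itv x; rewrite intrB => /andP[lt_x ->] /=; lra.
Qed.

Theorem proposition4p2 (R : realType) (k : nat) (alpha : R)
    (hk : (3 <= k)%N) (alpha_gt0 : 0 < alpha)
    (alpha_lt : alpha < 1 / (10 * k%:R)) :
  exists n0 : nat, forall n : nat, (n0 <= n)%N ->
  forall (V : finType) (S : 'I_(2 * ceiln (alpha * n%:R)) -> {set V})
    (E : 'I_(2 * ceiln (alpha * n%:R)) -> {set {set V}}),
  #|V| = n ->
  (forall j, #|S j| = (k - 1)%N) ->
  (forall i j, i != j -> [disjoint S i & S j]) ->
  (forall j, E j \subset edges_containing (complete_kgraph V k) (S j)) ->
  (forall j, #|E j| = (1 + ceiln (alpha * n%:R))%N) ->
  let G := retain_edges k S E in
  (forall f : V -> 'I_n, bijective f ->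
   forall (A : {set V}) (r : nat), #|A| = (k - 2)%N -> (1 <= r)%N ->
     r%:R < Num.min (min_label f A)%:R ((n%:R - k%:R + 2) / 2) :> R ->
     r%:R + alpha * n%:R <= (codeg G A r)%:R)
  /\
  ~ (exists f : V -> 'I_n, bijective f /\
     forall T : {set V}, #|T| = (k - 1)%N ->
       Num.min (min_label f T)%:R ((n%:R - k%:R + 2) / 2) + 1
         <= (deg G T)%:R :> R).
Proof.
(* With [alpha < 1 / 30], this makes [n - 2 * (k - 1)] exceed both [(n - k + 2) / 2 + alpha * n] and
   [m + 1]. *)
exists (10 * k)%N => n le_n V S E card_V card_S disj_S sub_E card_E G.
have k3 : 3 <= k%:R :> R by rewrite (ler_nat _ 3).
have n10k : 10 * k%:R <= n%:R :> R by rewrite -natrM ler_nat.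
have alpha30 : alpha * 30 <= 1.
  have /ltW := alpha_lt; rewrite ler_pdivlMr; last by lra.
  by apply: le_trans; rewrite ler_wpM2l; lra.
have an_gt0 : 0 < alpha * n%:R by rewrite mulr_gt0 //; lra.
have an_le : alpha * n%:R * 30 <= n%:R by rewrite mulrAC ler_piMl.
have /andP[m_ge m_lt] := ceiln_itv (ltW an_gt0).
have sub_E' := edges_containing_retained hk card_S disj_S sub_E.
set m := ceiln _ in S E card_S disj_S sub_E card_E G sub_E' m_ge m_lt *.
have m_gt0 : (0 < m)%N by rewrite -(ltr_nat R); lra.
have le_m : (30 * m <= n + 30)%N by rewrite -(ler_nat R) natrM natrD; lra.
split.
  move=> f _ A r card_A r_ge1; rewrite lt_min => /andP[_ lt_r].
  have ltN_r : (2 * r + k < n + 2)%N by rewrite -(ltr_nat R) natrD natrM natrD; lra.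
  have [r_gt1|r_le1] := ltnP 1 r.
    have le_r : (r <= #|V| - (k - 2))%N by lia.
    have := leq_codeg E hk card_S disj_S card_A r_gt1 le_r.
    rewrite card_V -(ler_nat R) natrD natrM natrB; last by lia.
    by rewrite -/G; lra.
  (* Here the retained degree [1 + m] suffices, since [m >= alpha * n]. *)
  have -> : r = 1%N by lia.
  have : (1 + m <= codeg G A 1)%N.
    apply: leq_codeg1 => //; first by move=> j; rewrite card_E.
    by rewrite card_V; lia.
  by rewrite -(ler_nat R) natrD; lra.
case=> f [/bij_inj inj_f degT].
have [||j] := disjoint_family_min_label inj_f _ _ disj_S; try by lia.
rewrite -(ler_nat R) natrM => le_min.
have := degT _ (card_S j).
rewrite /deg sub_E' card_E natrD addrC lerD2l ge_min.
have m_ge1 : 1 <= m%:R :> R by rewrite (ler_nat _ 1).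
(* A degree of [m + 1] would force the minimum to be at most [m], but the label is at least [2 * m]
   and [(n - k + 2) / 2] exceeds [m], as [m < n / 30 + 1]. *)
by case/orP; lra.
Qed.
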